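(* Let $0<\alpha\le\infty$ and let $f$ be a real function on $(-\alpha,\alpha)$. Then $f\in S_{\mathrm{pos}}^{(2)}(-\alpha,\alpha)$ if and only if $f|_{(0,\alpha)}\in\Phi(0,\alpha)$, $0\le f(0)\le f(0+)$ (where $f(0+):=\lim_{t\searrow0}f(t)$), and $|f(-t)|\le f(t)$ for all $0<t<\alpha$.
   Context: For a real matrix $A=[a_{ij}]$ with all entries in $(-\alpha,\alpha)$, $f[A]:=[f(a_{ij})]$. For real symmetric matrices, $A\ge0$ means positive semidefinite. $S_{\mathrm{pos}}^{(n)}(-\alpha,\alpha)$ is the set of real functions $f$ on $(-\alpha,\alpha)$ such that $f[A]\ge0$ for all $A\ge0$ in $M_n(\mathbb{R})$ with entries in $(-\alpha,\alpha)$. $\Phi(0,\alpha)$ is the set of all nonnegative functions $f$ on $(0,\alpha)$ which are non-decreasing and satisfy $f(\sqrt{st})\le\sqrt{f(s)f(t)}$ for all $s,t\in(0,\alpha)$. *)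

(* Defs.v *)
From mathcomp Require Export all_boot all_order all_algebra sesquilinear.
From mathcomp Require Export all_classical all_reals all_analysis.

Set Implicit Arguments.
Unset Strict Implicit.
Unset Printing Implicit Defensive.

Export Order.TTheory GRing.Theory Num.Theory.
Export numFieldNormedType.Exports.

Local Open Scope classical_set_scope.
Local Open Scope ring_scope.

(* The endpoints are extended reals so that [ereal_oo (- alpha) alpha] also
   covers the case alpha = +oo.  A function on such an interval is represented
   by a total function R -> R of which only the values on the interval matter. *)
Definition ereal_oo (R : realType) (a b : \bar R) : set R :=
  [set x | (a < x%:E < b)%E].

Definition psdmx (R : realType) (n : nat) (A : 'M[R]_n) : Prop :=
  A \is symmetricmx /\ forall x : 'cV[R]_n, 0 <= (x^T *m A *m x) 0 0.

Definition S_pos (R : realType) (n : nat) (alpha : \bar R) : set (R -> R) :=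
  [set f | forall A : 'M[R]_n, psdmx A ->
     (forall i j, ereal_oo (- alpha)%E alpha (A i j)) -> psdmx (map_mx f A)].

Definition Phi (R : realType) (alpha : \bar R) : set (R -> R) :=
  [set f | [/\ forall t, ereal_oo 0%E alpha t -> 0 <= f t,
     forall s t, ereal_oo 0%E alpha s -> ereal_oo 0%E alpha t ->
       s <= t -> f s <= f t &
     forall s t, ereal_oo 0%E alpha s -> ereal_oo 0%E alpha t ->
       f (Num.sqrt (s * t)) <= Num.sqrt (f s * f t)]].

(* Main.v *)
Require Import Defs.
From mathcomp Require Import ring lra.

Set Implicit Arguments.
Unset Strict Implicit.
Unset Printing Implicit Defensive.

Local Open Scope classical_set_scope.
Local Open Scope ring_scope.

(** A real symmetric 2 x 2 matrix with diagonal entries a, d and off-diagonal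
    entry b is positive semidefinite exactly when a and d are nonnegative and
    b^2 <= a d.  So f preserves positivity of 2 x 2 matrices if and only if
    these inequalities for (a, b, d) imply the same ones for
    (f a, f b, f d) ([S_pos2P]), and the rest is about numbers.

    Necessity: the matrix with diagonal t, t and off-diagonal entry x, where
    |x| <= t, gives |f x| <= f t.  Taking 0 < x <= t, x = 0 and x = - t yields
    monotonicity, f 0 <= f t and |f (- t)| <= f t.  The matrix with diagonal
    s, t and off-diagonal entry sqrt (s t) gives the multiplicative midpoint
    inequality.

    Sufficiency: let b^2 <= a d.  If b is nonzero, then a, d > 0 and
    |b| <= sqrt (a d), whence
      |f b| <= f |b| <= f (sqrt (a d)) <= sqrt (f a * f d).
    If b = 0, it suffices that f 0 is at most f a and f d.

    The only analytic point is that, for f nonnegative and nondecreasing on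
    (0, alpha), the condition f 0 <= f (0+) amounts to f 0 <= f t for all t in
    (0, alpha) ([le_lim_at_right0P]); the limit exists by monotonicity. *)

(** * Positive semidefinite 2 x 2 matrices *)

(** Both directions come from completing the square:
    a (a u^2 + 2 b u v + d v^2) = (a u + b v)^2 + (a d - b^2) v^2.
    The case a = 0 is treated apart, since the identity is then empty. *)
Lemma binary_form_ge0P (R : realFieldType) (a b d : R) :
  (forall u v : R, 0 <= a * u ^+ 2 + 2 * b * u * v + d * v ^+ 2) <->
  [/\ 0 <= a, 0 <= d & b ^+ 2 <= a * d].
Proof.
split=> [form_ge0 | [a_ge0 d_ge0 b2_le] u v].
  have a_ge0 : 0 <= a by have := form_ge0 1 0; lra.
  have d_ge0 : 0 <= d by have := form_ge0 0 1; lra.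
  split=> //; have [a0 | a_neq0] := eqVneq a 0.
    (* On the vector (- (d + 1), b) the form is then - (d + 2) b^2. *)
    have := form_ge0 (- (d + 1)) b; rewrite a0.
    have -> : 0 * (- (d + 1)) ^+ 2 + 2 * b * - (d + 1) * b + d * b ^+ 2 =
      - ((d + 2) * b ^+ 2) by ring.
    by rewrite mul0r oppr_ge0 pmulr_rle0 //; lra.
  (* On the vector (- b, a) the form is a times the determinant. *)
  have := form_ge0 (- b) a.
  have -> : a * (- b) ^+ 2 + 2 * b * - b * a + d * a ^+ 2 =
    a * (a * d - b ^+ 2) by ring.
  by rewrite pmulr_rge0 ?lt_def ?a_neq0 // subr_ge0.
have [a0 | a_neq0] := eqVneq a 0.
  have /eqP -> : b == 0 by rewrite -sqrf_eq0 eq_le sqr_ge0 andbT -(mul0r d) -a0.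
  rewrite a0.
  by rewrite mulr0 !mul0r !add0r mulr_ge0 // sqr_ge0.
have a_gt0 : 0 < a by rewrite lt_def a_neq0.
rewrite -(pmulr_rge0 _ a_gt0).
have -> : a * (a * u ^+ 2 + 2 * b * u * v + d * v ^+ 2) =
  (a * u + b * v) ^+ 2 + (a * d - b ^+ 2) * v ^+ 2 by ring.
by rewrite addr_ge0 ?sqr_ge0 // mulr_ge0 ?sqr_ge0 ?subr_ge0.
Qed.

Lemma ord2_cases (i : 'I_2) : i = 0 \/ i = 1.
Proof.
by case: i => -[|[|//]] i_lt2; [left | right]; apply: val_inj.
Qed.

Lemma psdmx2P (R : realType) (A : 'M[R]_2) :
  psdmx A <->
  A 0 1 = A 1 0 /\ [/\ 0 <= A 0 0, 0 <= A 1 1 & A 0 1 ^+ 2 <= A 0 0 * A 1 1].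
Proof.
have symP : A \is symmetricmx <-> A 0 1 = A 1 0.
  split=> [/is_hermitianmxP /matrixP /(_ 0 1) | A01].
    by rewrite !mxE expr0 mul1r.
  apply/is_hermitianmxP/matrixP => i j; rewrite !mxE expr0 mul1r.
  by case: (ord2_cases i) => ->; case: (ord2_cases j) => ->.
have quadE (x : 'cV[R]_2) : A 0 1 = A 1 0 -> (x^T *m A *m x) 0 0 =
    A 0 0 * x 0 0 ^+ 2 + 2 * A 0 1 * x 0 0 * x 1 0 + A 1 1 * x 1 0 ^+ 2.
  move=> A01; rewrite !mxE !big_ord_recl big_ord0 !mxE.
  rewrite !big_ord_recl !big_ord0 !mxE.
  have -> : lift ord0 ord0 = 1 :> 'I_2 by apply/val_inj.
  by rewrite -A01; ring.
rewrite /psdmx -binary_form_ge0P; split=> -[sym pos].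
  move/symP: sym => A01; split=> // u v.
  have := pos (\col_i if i == 0 then u else v).
  by rewrite quadE // !mxE.
by split=> [|x]; [exact/symP | rewrite quadE].
Qed.

(** * Intervals with extended real endpoints *)

Lemma ereal_oo_symE (R : realType) (alpha : \bar R) (x : R) :
  ereal_oo (- alpha)%E alpha x = (`|x|%:E < alpha)%E :> Prop.
Proof.
rewrite /ereal_oo /=; case: alpha => [r| |] /=.
- by rewrite !lte_fin ltr_norml.
- by rewrite ltNyr !ltry.
- by rewrite ltNge leNye.
Qed.

Lemma ereal_oo0E (R : realType) (alpha : \bar R) (t : R) :
  ereal_oo 0%E alpha t = (0 < t) && (t%:E < alpha)%E :> Prop.
Proof. by rewrite /ereal_oo /= lte_fin. Qed.

(** * Reduction to scalar inequalities *)

Lemma norm_le_max (R : realFieldType) (a b d : R) :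
  0 <= a -> 0 <= d -> b ^+ 2 <= a * d -> `|b| <= Num.max a d.
Proof.
move=> a_ge0 d_ge0 b2_le; have max_ge0 : 0 <= Num.max a d by rewrite le_max a_ge0.
rewrite -ler_sqr ?nnegrE // real_normK ?num_real //.
by apply: le_trans b2_le _; rewrite expr2 ler_pM // le_max lexx ?orbT.
Qed.

(** The off-diagonal entry b of a positive semidefinite matrix satisfies
    |b| <= max a d, so only the diagonal entries need to be bounded. *)
Lemma S_pos2P (R : realType) (alpha : \bar R) (f : R -> R) :
  S_pos 2 alpha f <->
  forall a b d : R, (a%:E < alpha)%E -> (d%:E < alpha)%E ->
    [/\ 0 <= a, 0 <= d & b ^+ 2 <= a * d] ->
    [/\ 0 <= f a, 0 <= f d & f b ^+ 2 <= f a * f d].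
Proof.
split=> [f_pos a b d a_lt d_lt abd | f_pos A /psdmx2P [A01 Apos] A_in].
  pose A : 'M[R]_2 :=
    \matrix_(i, j) (if i == j then if i == 0 then a else d else b).
  have /f_pos : psdmx A by apply/psdmx2P; rewrite !mxE.
  have [a_ge0 d_ge0 /(norm_le_max a_ge0 d_ge0) b_le] := abd.
  have b_lt : (`|b|%:E < alpha)%E.
    apply: le_lt_trans (_ : ((Num.max a d)%:E < alpha)%E); first by rewrite lee_fin.
    by rewrite maxEle; case: ifP.
  have A_in i j : ereal_oo (- alpha)%E alpha (A i j).
    rewrite ereal_oo_symE mxE; case: ifP => // _.
    by case: ifP => _; rewrite ger0_norm.
  by move=> /(_ A_in) /psdmx2P; rewrite !mxE => -[].
apply/psdmx2P; rewrite !mxE A01; split=> //; rewrite -A01.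
by apply: f_pos Apos; [have := A_in 0 0 | have := A_in 1 1];
  rewrite ereal_oo_symE; apply: le_lt_trans; rewrite lee_fin ler_norm.
Qed.

(** * The right limit at zero *)

(** A function in Phi is nondecreasing and bounded below by 0 near 0, so its
    right limit at 0 exists and is the infimum of its values on (0, alpha);
    [lim] would be meaningless if existence failed. *)
Lemma le_lim_at_right0P (R : realType) (alpha : \bar R) (f : R -> R) (c : R) :
  (0 < alpha)%E -> Phi alpha f ->
  c <= lim (f t @[t --> 0^'+]) <-> forall t, ereal_oo 0%E alpha t -> c <= f t.
Proof.
move=> alpha_gt0 [f_ge0 f_homo _].
have oo_down t x : ereal_oo 0%E alpha t -> 0 < x <= t -> ereal_oo 0%E alpha x.
  rewrite !ereal_oo0E => /andP[_ t_lt] /andP[-> xt] /=.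
  by apply: le_lt_trans t_lt; rewrite lee_fin.
have [e e_in] : exists e, ereal_oo 0%E alpha e.
  case: alpha alpha_gt0 {f_ge0 f_homo oo_down} => [r| |] //.
    rewrite lte_fin => r_gt0; exists (r / 2); rewrite ereal_oo0E lte_fin.
    by apply/andP; split; lra.
  by exists 1; rewrite ereal_oo0E ltr01 ltry.
have e_gt0 : 0 < e by move: e_in; rewrite ereal_oo0E => /andP[].
have near_le t : 0 < t -> \forall x \near 0^'+, 0 < x <= t.
  by move=> t_gt0; near=> x; apply/andP; split; near: x;
    [exact: nbhs_right_gt | exact: nbhs_right_ltW].
have f_cvg : cvg (f t @[t --> 0^'+]).
  apply: nondecreasing_at_right_is_cvgr; near=> y.
    have ye : 0 < y <= e by near: y; exact: near_le.
    have in_y x : x \in `]0, y[ -> ereal_oo 0%E alpha x.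
      rewrite in_itv /= => /andP[x_gt0 xy]; apply: (oo_down e) => //.
      by rewrite x_gt0 (le_trans (ltW xy)) //; case/andP: ye.
    by move=> s t /in_y s_in /in_y t_in; exact: f_homo.
  have ye : 0 < y <= e by near: y; exact: near_le.
  exists 0 => _ [x /= + <-]; rewrite in_itv /= => /andP[x_gt0 xy].
  by apply/f_ge0/(oo_down e) => //; rewrite x_gt0 (le_trans (ltW xy)) //; case/andP: ye.
split=> [c_le t t_in | c_le].
  have t_gt0 : 0 < t by move: t_in; rewrite ereal_oo0E => /andP[].
  apply: le_trans c_le _; apply: limr_le => //.
  near=> x; have xt : 0 < x <= t by near: x; exact: near_le.
  by apply: f_homo (oo_down _ _ t_in xt) t_in _; case/andP: xt.
apply: limr_ge => //; near=> x.
by apply/c_le/(oo_down e) => //; near: x; exact: near_le.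
Unshelve. all: by end_near. Qed.

(** * The characterization *)

Theorem proposition2p2 (R : realType) (alpha : \bar R) (halpha : (0 < alpha)%E)
    (f : R -> R) :
  S_pos 2 alpha f <->
  [/\ Phi alpha f,
      0 <= f 0 <= lim (f t @[t --> 0^'+]) &
      forall t : R, ereal_oo 0%E alpha t -> `|f (- t)| <= f t].
Proof.
split=> [/S_pos2P f_pos | [Phi_f /andP[f0_ge0 f0_lim] f_opp]].
  have f_ge0 t : 0 <= t -> (t%:E < alpha)%E -> 0 <= f t.
    move=> t_ge0 t_lt; have [|//] := f_pos t t t t_lt t_lt.
    by rewrite t_ge0 -expr2.
  have f_norm x t : `|x| <= t -> (t%:E < alpha)%E -> `|f x| <= f t.
    move=> xt t_lt; have t_ge0 : 0 <= t := le_trans (normr_ge0 x) xt.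
    have [|ft_ge0 _] := f_pos t x t t_lt t_lt.
      by rewrite t_ge0 -expr2 -(real_normK (num_real x)) ler_sqr ?nnegrE.
    by rewrite -expr2 -(real_normK (num_real (f x))) ler_sqr ?nnegrE.
  have Phi_f : Phi alpha f.
    split=> [t | s t | s t]; rewrite !ereal_oo0E.
    - by move=> /andP[/ltW t_ge0]; exact: f_ge0.
    - move=> /andP[/ltW s_ge0 _] /andP[_ t_lt] st.
      by apply: le_trans (ler_norm _) (f_norm _ _ _ t_lt); rewrite ger0_norm.
    - move=> /andP[/ltW s_ge0 s_lt] /andP[/ltW t_ge0 t_lt].
      have [|fs_ge0 ft_ge0 le_fst] := f_pos s (Num.sqrt (s * t)) t s_lt t_lt.
        by rewrite sqr_sqrtr ?mulr_ge0.
      by apply: le_trans (ler_norm _) _; rewrite -sqrtr_sqr ler_wsqrtr.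
  split=> //; last first.
    move=> t; rewrite ereal_oo0E => /andP[/ltW t_ge0].
    by apply: f_norm; rewrite normrN ger0_norm.
  rewrite f_ge0 //=; apply/(le_lim_at_right0P _ halpha Phi_f) => t.
  rewrite ereal_oo0E => /andP[/ltW t_ge0 t_lt].
  by apply: le_trans (ler_norm _) (f_norm _ _ _ t_lt); rewrite normr0.
have f0_le t : 0 <= t -> (t%:E < alpha)%E -> f 0 <= f t.
  rewrite le_eqVlt => /predU1P[<- // | t_gt0 t_lt].
  by apply: (le_lim_at_right0P _ halpha Phi_f).1 => //; rewrite ereal_oo0E t_gt0.
have [f_ge0 f_homo f_sqrt] := Phi_f.
apply/S_pos2P => a b d a_lt d_lt [a_ge0 d_ge0 b2_le].
have fa_ge := f0_le a a_ge0 a_lt; have fd_ge := f0_le d d_ge0 d_lt.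
have fa_ge0 := le_trans f0_ge0 fa_ge; have fd_ge0 := le_trans f0_ge0 fd_ge.
split=> //; have [-> | b_neq0] := eqVneq b 0; first by rewrite expr2 ler_pM.
have ad_gt0 : 0 < a * d by rewrite (lt_le_trans _ b2_le) ?exprn_even_gt0.
have a_gt0 : 0 < a.
  by rewrite lt_def a_ge0 andbT; apply: contraTneq ad_gt0 => ->; rewrite mul0r ltxx.
have d_gt0 : 0 < d by rewrite -(pmulr_rgt0 _ a_gt0).
have norm_b_le : `|b| <= Num.sqrt (a * d) by rewrite -sqrtr_sqr ler_wsqrtr.
have in_oo x : 0 < x -> x ^+ 2 <= a * d -> ereal_oo 0%E alpha x.
  move=> x_gt0 /(norm_le_max a_ge0 d_ge0); rewrite gtr0_norm // ereal_oo0E x_gt0 /=.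
  rewrite -lee_fin => /le_lt_trans; apply.
  by rewrite maxEle; case: ifP.
have norm_b_in : ereal_oo 0%E alpha `|b|.
  by apply: in_oo; rewrite ?normr_gt0 // real_normK ?num_real.
have sqrt_in : ereal_oo 0%E alpha (Num.sqrt (a * d)).
  by apply: in_oo; rewrite ?sqrtr_gt0 // sqr_sqrtr // ltW.
have fb_le : `|f b| <= f `|b|.
  have [b_ge0 | b_lt0] := ger0P b.
    by move: norm_b_in; rewrite ger0_norm // => /f_ge0 /ger0_norm ->.
  by move: norm_b_in; rewrite ltr0_norm // => /f_opp; rewrite opprK.
have a_in : ereal_oo 0%E alpha a by rewrite ereal_oo0E a_gt0.
have d_in : ereal_oo 0%E alpha d by rewrite ereal_oo0E d_gt0.
have {}fb_le : `|f b| <= Num.sqrt (f a * f d).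
  apply: le_trans fb_le _; apply: le_trans (f_sqrt _ _ a_in d_in).
  exact: f_homo.
rewrite -(sqr_sqrtr (mulr_ge0 fa_ge0 fd_ge0)) -(real_normK (num_real (f b))).
by rewrite ler_sqr ?nnegrE ?sqrtr_ge0.
Qed.
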